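(* Let $\tilde f$ be a generic small perturbation of the elliptic umbilic $f(y_1,y_2)=\frac13y_1^3-y_1y_2^2$, and let $\widehat{\widetilde E}$ be its Morse homology bundle, glued across the folds of the caustic $\widetilde K$ by the fold isomorphisms. Let $A$ be a 1-dimensional submanifold of $\mathbb R^2$ consisting of three disjoint half-lines, each with vertex at one of the three cusps of $\widetilde K$. If $\widehat{\widetilde E}$ is glued along each half-line of $A$ by the inverse of the corresponding cusp monodromy matrix (as defined in the context), then its holomorphic structure can be extended across the cusps; i.e. the composition of the gluing isomorphisms along a small simple loop around each cusp is the identity.
   Context: **Perturbation and caustic.** $\tilde f:\mathbb R^2\to\mathbb R$ is a generic small perturbation of $f$, equal to $f$ outside a compact set. For $x\in\mathbb R^2$ put $\tilde f_x(y)=\tilde f(y)-x\cdot y$ and consider the gradient system $dy/dt=\nabla\tilde f_x(y)$, whose solutions are called gradient lines. $\widetilde K$ (caustic) is the set of $x$ for which $\tilde f_x$ has a degenerate critical point. $\widetilde B$ (bifurcation locus) is the set of $x$ for which $\tilde f_x$ is Morse but some gradient line joins two saddles. Known facts, taken as given: $\widetilde K$ is a tricuspoid (closed curve with three cusps joined by three sides of folds). For $x$ inside $\widetilde K$, $\tilde f_x$ has four critical points when Morse: three saddles $s_1,s_2,s_3$ (index 1, labelled continuously) and a node $n$ (index 2). For $x$ outside, it has exactly two critical points, both saddles. Denote by $l_i$ the side of $\widetilde K$ along which $n$ and $s_i$ merge and disappear; at the cusp common to $l_i$ and $l_j$ the points $n,s_i,s_j$ merge. Generically no bifurcation line passes near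 a cusp. **The bundle.** For $x$ inside $\widetilde K$, $x\notin\widetilde B$, let $I(x)_i=1$ if there is a gradient line from $n(x)$ to $s_i(x)$ and $I(x)_i=0$ otherwise, and $\partial_xn=\sum_iI(x)_is_i$. The fibre of $\widehat{\widetilde E}$ over $x\notin\widetilde K\cup\widetilde B$ is the Morse homology: $\big(\bigoplus_{i=1}^3\mathbb C[s_i(x)]\big)/\mathbb C\,\partial_xn$ inside $\widetilde K$, and $\mathbb C[s_j(x)]\oplus\mathbb C[s_k(x)]$ (the two saddles) outside. Over each component of $\mathbb R^2\setminus(\widetilde K\cup\widetilde B)$ the bundle is trivial with this fibre. Holomorphic sections over the dual torus fibration, with coordinates $(x,w)$, are obtained by multiplying constant sections by weights $\exp[2\pi(\frac{h(x)}2-\frac{A(x)}{4\pi}+i\frac{\partial h}{\partial x}\cdot w)]$, where $h$ is the local generating function (in base coordinates) of the corresponding sheet of the Lagrangian and in this formula $A$ denotes the connection form of the given flat $U(1)$-connection $d+A$. Gluings are defined on the unweighted sections, and the structure is said to extend across a point when the composition of the gluings around it is trivial. **Gluing along folds.** Across a fold point of $l_i$ which is not a limit point of $\widetilde B$, the fibres outside and inside are identified by the isomorphism induced in homology by the inclusion $\mathbb C[s_j]\oplus\mathbb C[s_k]\hookrightarrow\bigoplus_{l=1}^3\mathbb C[s_l]$, $\{j,k\}=\{1,2,3\}\setminus\{i\}$. **Gluing along $A$.** Each half-line of $A$ lies outside $\widetilde K$. Outside $\widetilde K$, on the part adjacent to $l_k$ (up to the half-lines of $A$), the two saddles are labelled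 $s_j$, $j\neq k$, by continuation across $l_k$, and fibres are identified with $\mathbb C^2$ by listing the two saddles in increasing order of index. At the cusp $c$ common to $l_i$ and $l_j$, the cusp monodromy matrix $M$ is the matrix, in these coordinates, of the passage near $c$ from the exterior to the interior through $l_i$ and back to the exterior through $l_j$. Gluing across the half-line of $A$ with vertex $c$, from the part adjacent to $l_j$ to the part adjacent to $l_i$, is $M^{-1}$. Explicitly, call case (a) the case in which near $c$, inside $\widetilde K$, there are gradient lines from $n$ to all three saddles, and case (b) the case in which there are only gradient lines from $n$ to the two saddles merging with it at $c$. Then $M$ is: for $\{i,j\}=\{2,3\}$, $\left(\begin{smallmatrix}1&-1\\0&-1\end{smallmatrix}\right)$ in case (a), $\left(\begin{smallmatrix}1&0\\0&-1\end{smallmatrix}\right)$ in case (b); for $\{i,j\}=\{1,2\}$, $\left(\begin{smallmatrix}-1&0\\-1&1\end{smallmatrix}\right)$ in case (a), $\left(\begin{smallmatrix}-1&0\\0&1\end{smallmatrix}\right)$ in case (b); for $(i,j)=(1,3)$, $\left(\begin{smallmatrix}0&-1\\1&-1\end{smallmatrix}\right)$ in case (a), $\left(\begin{smallmatrix}0&-1\\1&0\end{smallmatrix}\right)$ in case (b), and the inverses of these for $(i,j)=(3,1)$. *)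

(* Defs.v *)
(* Points of the plane are row vectors, with coordinates y1 = y 0 0 and
   y2 = y 0 1. The labels 1, 2, 3 of the source are 0, 1, 2 : 'I_3. *)
From HB Require Import structures.
From mathcomp Require Import all_boot all_order all_algebra.
From mathcomp Require Import generic_quotient ring_quotient complex.
From mathcomp Require Import all_classical all_reals all_analysis.
Import Order.TTheory GRing.Theory Num.Theory.
Import numFieldNormedType.Exports.

Set Implicit Arguments.
Unset Strict Implicit.
Unset Printing Implicit Defensive.

Local Open Scope classical_set_scope.
Local Open Scope ring_scope.

Section VspaceQuotient.
Variables (F : fieldType) (V : vectType F) (D : {vspace V}).

Definition vquot : Type := Quotient.quot D.

HB.instance Definition _ := GRing.Zmodule.on vquot.

Definition vquot_pi (v : V) : vquot := (\pi_(Quotient.quot D) v)%qT.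
Definition vquot_repr (q : vquot) : V := repr (q : Quotient.quot D).

Lemma vquot_reprK q : vquot_pi (vquot_repr q) = q.
Proof. exact: reprK. Qed.

Lemma vquot_piP u v : (vquot_pi u = vquot_pi v) <-> (u - v \in D).
Proof.
by rewrite -[u - v \in D]/(Quotient.equiv D u v); split=> [/eqquotP|h]; last exact/eqquotP.
Qed.

Lemma vquot_piD u v : vquot_pi (u + v) = vquot_pi u + vquot_pi v.
Proof. exact: (raddfD (\pi_(Quotient.quot D))%qT). Qed.

Definition vquot_scale (a : F) (q : vquot) : vquot :=
  vquot_pi (a *: vquot_repr q).

Lemma vquot_piZ a v : vquot_pi (a *: v) = vquot_scale a (vquot_pi v).
Proof.
by apply/vquot_piP; rewrite -scalerBr memvZ //; apply/vquot_piP; rewrite vquot_reprK.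
Qed.

Lemma vquot_scaleA a b q :
  vquot_scale a (vquot_scale b q) = vquot_scale (a * b) q.
Proof. by rewrite -[q]vquot_reprK -!vquot_piZ scalerA. Qed.

Lemma vquot_scale1 : left_id 1 vquot_scale.
Proof. by move=> q; rewrite -[q]vquot_reprK -vquot_piZ scale1r. Qed.

Lemma vquot_scaleDr : right_distributive vquot_scale +%R.
Proof.
move=> a p q; rewrite -[p]vquot_reprK -[q]vquot_reprK.
by rewrite -vquot_piD -!vquot_piZ scalerDr vquot_piD.
Qed.

Lemma vquot_scaleDl q : {morph vquot_scale^~ q : a b / a + b}.
Proof.
by move=> a b; rewrite -[q]vquot_reprK -!vquot_piZ scalerDl vquot_piD.
Qed.

HB.instance Definition _ := GRing.Zmodule_isLmodule.Build F vquot
  vquot_scaleA vquot_scale1 vquot_scaleDr vquot_scaleDl.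

End VspaceQuotient.

Section PlaneCalculus.
Variable R : realType.
Local Notation plane := 'rV[R]_2.

Definition partial (i : 'I_2) (g : plane -> R) : plane -> R :=
  fun y => 'D_(delta_mx 0 i) g y.

Definition smooth (g : plane -> R) : Prop :=
  forall (s : seq 'I_2) (y : plane), differentiable (foldr partial g s) y.

Definition grad (g : plane -> R) (y : plane) : plane := \row_i partial i g y.

Definition hessian (g : plane -> R) (y : plane) : 'M[R]_2 :=
  \matrix_(i, j) partial i (partial j g) y.

Definition smooth_curve (k : R -> plane) : Prop :=
  forall (m : nat) (t : R), derivable (derive1n m k) t 1.

Definition elliptic_umbilic (y : plane) : R :=
  3^-1 * y 0 0 ^+ 3 - y 0 0 * y 0 1 ^+ 2.

Definition critical (g : plane -> R) (y : plane) : Prop := grad g y = 0.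

Definition degenerate (g : plane -> R) (y : plane) : Prop :=
  \det (hessian g y) = 0.

Definition pos_def_on (H W : 'M[R]_2) : Prop :=
  forall v : plane, (v <= W)%MS -> v != 0 -> 0 < (v *m H *m v^T) 0 0.

(* The source orients gradient lines from the node (index 2) to the saddles
   (index 1). With rev = false they are solutions of dy/dt = grad g, and the
   index is the dimension of the unstable space of this flow; with rev = true
   they are the same curves run backwards, and the index is the Morse index
   (number of negative eigenvalues of the Hessian). The node is a source of the
   oriented flow in both cases: a minimum of g if rev = false, a maximum of g if
   rev = true. *)
Definition critical_index (rev : bool) (g : plane -> R) (y : plane) (m : nat) :
    Prop :=
  (exists W : 'M[R]_2,
     pos_def_on ((-1) ^+ rev *: hessian g y) W /\ \rank W = m) /\
  (forall W : 'M[R]_2,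
     pos_def_on ((-1) ^+ rev *: hessian g y) W -> (\rank W <= m)%N).

Definition nondegenerate_of_index (rev : bool) (g : plane -> R) (m : nat)
    (y : plane) : Prop :=
  [/\ critical g y, ~ degenerate g y & critical_index rev g y m].

Definition gradient_line (rev : bool) (g : plane -> R) (p q : plane) : Prop :=
  exists u : R -> plane,
    [/\ forall t : R,
          derivable u t 1 /\ derive1 u t = (-1) ^+ rev *: grad g (u t),
        u t @[t --> -oo] --> p & u t @[t --> +oo] --> q].

End PlaneCalculus.

Section Caustic.
Variable R : realType.
Local Notation plane := 'rV[R]_2.

Definition tilt (ft : plane -> R) (x y : plane) : R :=
  ft y - \sum_i x 0 i * y 0 i.

Definition caustic (ft : plane -> R) : set plane :=
  [set x | exists y, critical (tilt ft x) y /\ degenerate (tilt ft x) y].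

Definition bifurcation (rev : bool) (ft : plane -> R) : set plane :=
  [set x | ~ caustic ft x /\ exists p q : plane,
     [/\ p != q, nondegenerate_of_index rev (tilt ft x) 1 p,
         nondegenerate_of_index rev (tilt ft x) 1 q &
         gradient_line rev (tilt ft x) p q]].

Definition inside (K : set plane) : set plane :=
  [set x | ~ K x /\ bounded_set (connected_component (~` K) x)].

Definition outside (K : set plane) : set plane :=
  [set x | ~ K x /\ ~ bounded_set (connected_component (~` K) x)].

(* Closed curve, smooth as a map, whose only singularities are three ordinary
   cusps, put at the parameters 0, 1/3, 2/3 of a parametrization of period 1.
   The side l i is the open arc opposite to the cusp c i, so that for
   {i, j, k} = {0, 1, 2} the cusp c k is the one common to l i and l j. *)
Definition tricuspoid (K : set plane) (c : 'I_3 -> plane)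
    (l : 'I_3 -> set plane) : Prop :=
  exists kappa : R -> plane,
    [/\ smooth_curve kappa /\ (forall t, kappa (t + 1) = kappa t),
        {in `[0, 1[ &, injective kappa} /\ K = range kappa,
        forall t, derive1 kappa t = 0 <-> exists m : int, t = m%:~R / 3,
        forall t, derive1 kappa t = 0 ->
          row_free (col_mx (derive1n 2 kappa t) (derive1n 3 kappa t)) &
        forall i : 'I_3, c i = kappa (i%:R / 3) /\
          l i = kappa @` `]i.+1%:R / 3, i.+2%:R / 3[].

(* s i and n are the saddles and the node of ft_x for x inside the caustic. *)
Record generic_perturbation (rev : bool) (ft : plane -> R)
    (c : 'I_3 -> plane) (l : 'I_3 -> set plane)
    (s : 'I_3 -> plane -> plane) (n : plane -> plane) : Prop := {
  gp_smooth : smooth ft;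
  gp_compact : exists C : set plane,
    compact C /\ forall y, ~ C y -> ft y = elliptic_umbilic y;
  gp_tricuspoid : tricuspoid (caustic ft) c l;
  gp_saddle : forall x i, inside (caustic ft) x ->
    nondegenerate_of_index rev (tilt ft x) 1 (s i x);
  gp_node : forall x, inside (caustic ft) x ->
    nondegenerate_of_index rev (tilt ft x) 2 (n x);
  gp_saddle_inj : forall x, inside (caustic ft) x -> injective (s^~ x);
  gp_inside : forall x y, inside (caustic ft) x -> critical (tilt ft x) y ->
    y = n x \/ exists i, y = s i x;
  gp_saddle_cont : forall i, {within inside (caustic ft), continuous (s i)};
  gp_node_cont : {within inside (caustic ft), continuous n};
  gp_outside : forall x, outside (caustic ft) x -> exists p q : plane,
    [/\ p != q, nondegenerate_of_index rev (tilt ft x) 1 p,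
        nondegenerate_of_index rev (tilt ft x) 1 q &
        forall y, critical (tilt ft x) y -> y = p \/ y = q];
  gp_fold : forall i p, l i p -> exists y : plane,
    s i @ within (inside (caustic ft)) (nbhs p) --> y /\
    n @ within (inside (caustic ft)) (nbhs p) --> y;
  gp_cusp : forall k, exists y : plane,
    n @ within (inside (caustic ft)) (nbhs (c k)) --> y /\
    forall i, i != k ->
      s i @ within (inside (caustic ft)) (nbhs (c k)) --> y;
  gp_cusp_bifurcation : forall k,
    \forall x \near c k, ~ bifurcation rev ft x
}.

(* I(x)_i *)
Definition incidence (rev : bool) (ft : plane -> R)
    (s : 'I_3 -> plane -> plane) (n : plane -> plane) (x : plane) (i : 'I_3) :
    bool :=
  `[< gradient_line rev (tilt ft x) (n x) (s i x) >].

Definition cusp_case_a (rev : bool) (ft : plane -> R) (c : 'I_3 -> plane)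
    (s : 'I_3 -> plane -> plane) (n : plane -> plane) (k : 'I_3) : Prop :=
  \forall x \near c k, inside (caustic ft) x ->
    forall i, incidence rev ft s n x i.

(* the saddles merging with n at c k are the s i with i != k *)
Definition cusp_case_b (rev : bool) (ft : plane -> R) (c : 'I_3 -> plane)
    (s : 'I_3 -> plane -> plane) (n : plane -> plane) (k : 'I_3) : Prop :=
  \forall x \near c k, inside (caustic ft) x ->
    forall i, incidence rev ft s n x i = (i != k).

(* Half-line, as a submanifold: proper smooth embedding of [0, +oo[; straight
   half-lines are a particular case. *)
Definition half_line (v : plane) (a : set plane) : Prop :=
  exists g : R -> plane,
    [/\ smooth_curve g /\ g 0 = v,
        forall t, 0 <= t -> derive1 g t != 0,
        {in `[0, +oo[ &, injective g},
        `|g t| @[t --> +oo] --> +oo &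
        a = g @` `[0, +oo[].

(* E k is the part of the exterior, cut along the half-lines a i, adjacent to
   l k; e k j, for j != k, is the saddle labelled s j in E k. Indices i != k
   below run over the two cusps at the ends of l k. *)
Record exterior_cut (rev : bool) (ft : plane -> R) (c : 'I_3 -> plane)
    (l : 'I_3 -> set plane) (s : 'I_3 -> plane -> plane)
    (a E : 'I_3 -> set plane) (e : 'I_3 -> 'I_3 -> plane -> plane) : Prop := {
  ec_half_line : forall k, half_line (c k) (a k);
  ec_disjoint : forall i j, i != j -> a i `&` a j = set0;
  ec_outside : forall k, a k `\ c k `<=` outside (caustic ft);
  ec_part_open : forall k, open (E k);
  ec_part_connected : forall k, connected (E k);
  ec_part_disjoint : forall i j, i != j -> E i `&` E j = set0;
  ec_part_cover : \bigcup_k E k = outside (caustic ft) `\` \bigcup_k a k;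
  ec_part_closure : forall k,
    closure (E k) = E k `|` l k `|` \bigcup_(i in [set i | i != k]) a i;
  ec_saddle : forall k j x, j != k -> E k x ->
    nondegenerate_of_index rev (tilt ft x) 1 (e k j x);
  ec_saddle_inj : forall k x, E k x ->
    {in [pred j | j != k] &, injective (fun j => e k j x)};
  ec_saddle_cont : forall k j, j != k -> {within E k, continuous (e k j)};
  ec_saddle_label : forall k j p, j != k -> l k p -> exists y : plane,
    s j @ within (inside (caustic ft)) (nbhs p) --> y /\
    e k j @ within (E k) (nbhs p) --> y
}.

End Caustic.

Section Bundle.
Variable R : realType.
Local Notation plane := 'rV[R]_2.
Local Notation C := R[i].
Variables (rev : bool) (ft : plane -> R) (c : 'I_3 -> plane)
  (s : 'I_3 -> plane -> plane) (n : plane -> plane) (E : 'I_3 -> set plane).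

Definition boundary_node (x : plane) : 'cV[C]_3 :=
  \col_i (incidence rev ft s n x i)%:R.

Definition region := option 'I_3.

(* For x off the caustic and the half-lines: Some k if x is in the exterior part
   E k, None if x is inside the caustic. *)
Definition region_of (x : plane) : region := [pick k | `[< E k x >]].

(* Inside the caustic, (+)_i C[s_i] is C^3 and d = boundary_node x; in E k,
   C^2 lists the two saddles s_j, j != k, in increasing order, i.e. the
   coordinate of index b is that of s_(lift k b). *)
Definition region_fibre (d : 'cV[C]_3) (r : region) : lmodType C :=
  if r is Some _ then 'cV[C]_2 : lmodType C
  else vquot <[d]>%VS : lmodType C.

Definition fibre (x : plane) : lmodType C :=
  region_fibre (boundary_node x) (region_of x).

Definition saddle_inclusion (k : 'I_3) (u : 'cV[C]_2) : 'cV[C]_3 :=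
  \sum_b u b 0 *: delta_mx (lift k b) 0.

Definition fold_in (k : 'I_3) (d : 'cV[C]_3) (u : 'cV[C]_2) : vquot <[d]>%VS :=
  vquot_pi <[d]>%VS (saddle_inclusion k u).

(* Inverse of fold_in, which is bijective when the coordinate of index k of d is
   not 0, as happens near l k where n and s k merge. *)
Definition fold_out (k : 'I_3) (d : 'cV[C]_3) (h : vquot <[d]>%VS) : 'cV[C]_2 :=
  xget 0 [set u | fold_in k d u = h].

Definition mx22 (a b a' b' : C) : 'M[C]_2 :=
  \matrix_(i, j) if i == 0 then (if j == 0 then a else b)
                 else (if j == 0 then a' else b').

(* M for the passage through l i, then l j, near their common cusp; the boolean
   is true in case (a). Columns are the images of the basis vectors. *)
Definition cusp_matrix (case_a : bool) (i j : 'I_3) : 'M[C]_2 :=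
  match nat_of_ord i, nat_of_ord j with
  | 1, 2 | 2, 1 => if case_a then mx22 1 (-1) 0 (-1) else mx22 1 0 0 (-1)
  | 0, 1 | 1, 0 => if case_a then mx22 (-1) 0 (-1) 1 else mx22 (-1) 0 0 1
  | 0, 2 => if case_a then mx22 0 (-1) 1 (-1) else mx22 0 (-1) 1 0
  | 2, 0 => invmx (if case_a then mx22 0 (-1) 1 (-1) else mx22 0 (-1) 1 0)
  | _, _ => 1%:M
  end.

(* Since 0 + 1 + 2 = 0 in Z/3, - (i + j) is the third index, that of the cusp
   common to l i and l j. *)
Definition cusp_monodromy (i j : 'I_3) : 'M[C]_2 :=
  cusp_matrix `[< cusp_case_a rev ft c s n (- (i + j)) >] i j.

(* Two distinct exterior parts E j and E i are glued across the half-line with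
   vertex the cusp common to l i and l j, the exterior part E k and the interior
   across l k; points of one region are compared by constant sections. *)
Definition region_glue (d d' : 'cV[C]_3) (r r' : region) :
    region_fibre d r -> region_fibre d' r' :=
  match r, r' return region_fibre d r -> region_fibre d' r' with
  | Some j, Some i =>
      fun u => if i == j then u else invmx (cusp_monodromy i j) *m u
  | Some k, None => fun u => fold_in k d' u
  | None, Some k => fun h => fold_out k h
  | None, None => fun h => vquot_pi <[d']>%VS (vquot_repr h)
  end.

Definition glue (x x' : plane) : fibre x -> fibre x' :=
  @region_glue (boundary_node x) (boundary_node x') (region_of x) (region_of x').

Fixpoint glue_along (x : plane) (xs : seq plane) (y : plane) :
    fibre x -> fibre y :=
  match xs with
  | [::] => @glue x y
  | z :: zs => fun u => @glue_along z zs y (@glue x z u)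
  end.

End Bundle.

Section Extension.
Variable R : realType.
Local Notation plane := 'rV[R]_2.

Definition simple_loop (g : R -> plane) : Prop :=
  [/\ {within `[0, 1], continuous g}, g 0 = g 1 &
      {in `[0, 1[ &, injective g}].

Definition encircles (g : R -> plane) (p : plane) : Prop :=
  ~ (g @` `[0, 1]) p /\
  bounded_set (connected_component (~` (g @` `[0, 1])) p).

(* 0 < ts_0 < .. < ts_m < 1 are such that the loop is off the walls at 0 and at
   the ts_i, and meets them at most once between two consecutive parameters. *)
Definition adapted (walls : set plane) (g : R -> plane) (ts : seq R) : Prop :=
  let rs := 0 :: rcons ts 1 in
  [/\ sorted <%R rs, forall t, t \in rs -> ~ walls (g t) &
      forall m, (m <= size ts)%N -> {in `]nth 0 rs m, nth 0 rs m.+1[ &,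
        forall t t', walls (g t) -> walls (g t') -> t = t'}].

(* Gluings act on unweighted sections, and the holomorphic structure extends
   across p when their composition along small simple loops around p is the
   identity. *)
Definition extends_across (rev : bool) (ft : plane -> R) (c : 'I_3 -> plane)
    (s : 'I_3 -> plane -> plane) (n : plane -> plane)
    (a E : 'I_3 -> set plane) (p : plane) : Prop :=
  exists U : set plane,
    [/\ nbhs p U, U `&` bifurcation rev ft = set0 &
        forall (g : R -> plane) (ts : seq R),
          simple_loop g -> g @` `[0, 1] `<=` U -> encircles g p ->
          adapted (caustic ft `|` \bigcup_k a k) g ts ->
          forall u : fibre rev ft s n E (g 0),
            glue_along c [seq g t | t <- ts] (g 0) u = u].

End Extension.

(* Main.v *)
Require Import Defs.
From mathcomp Require Import all_boot all_order all_algebra.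
From mathcomp Require Import all_classical all_reals all_analysis.
From mathcomp Require Import complex ring lra.

(** Near the cusp [c k] the homology of the interior is one fixed vector space.
    Indeed the boundary of the node is there a constant vector [d]: the sum of
    the three saddles in case (a), of the two that merge with the node in
    case (b). The three regions around the cusp are the interior
    and the exterior parts [E i], [E j] with [i], [j] different from [k], and
    each has a canonical map to the quotient of C^3 by the line of [d]: the
    identity for the interior, the fold map [fold_in] for an exterior part.

    The fold map of [l i] is bijective as soon as [d] has a nonzero coordinate
    of index [i] ([fold_in_inj], [fold_in_surj]), which holds at the two sides
    meeting at [c k] in both cases. The cusp monodromy matrix is the composition
    of one fold map with the inverse of the other ([cusp_matrix_passage]), so
    the gluing across the half-line, being its inverse, is again the change of
    coordinates between two fold maps. Hence every gluing, across a fold or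
    across the half-line, commutes with the maps to the common quotient
    ([develop_region_glue]). Composing gluings along any chain of regions that
    returns to its starting point therefore gives an endomorphism that becomes
    the identity in the quotient, and the map to the quotient is injective
    ([develop_inj]); so the composition is the identity
    ([glue_along_closed]).

    The remaining point is that a small neighbourhood of [c k] does not meet the
    third part [E k], where the coordinate of [d] may vanish and other matrices
    enter: the closure of [E k] adds to it only the side opposite to [c k] and
    the half-lines issued from the other two cusps ([cusp_not_closure_part]). *)

Import Order.TTheory GRing.Theory Num.Theory.
Import numFieldNormedType.Exports.

Set Implicit Arguments.
Unset Strict Implicit.
Unset Printing Implicit Defensive.

Local Open Scope classical_set_scope.
Local Open Scope ring_scope.

(** * Fold maps as coordinates on the homology of the interior *)

Section FoldMaps.
Variable R : realType.
Local Notation C := R[i].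

Lemma saddle_inclusionE (k m : 'I_3) (u : 'cV[C]_2) :
  saddle_inclusion k u m 0 = \sum_b u b 0 * (m == lift k b)%:R.
Proof.
rewrite /saddle_inclusion summxE.
by apply: eq_bigr => b _; rewrite !mxE eqxx andbT.
Qed.

Lemma saddle_inclusion_lift (k : 'I_3) b (u : 'cV[C]_2) :
  saddle_inclusion k u (lift k b) 0 = u b 0.
Proof.
rewrite saddle_inclusionE (bigD1 b) //= eqxx mulr1 big1 ?addr0 // => b' nb.
by rewrite (inj_eq lift_inj) eq_sym (negbTE nb) mulr0.
Qed.

Lemma saddle_inclusion_omitted (k : 'I_3) (u : 'cV[C]_2) :
  saddle_inclusion k u k 0 = 0.
Proof.
rewrite saddle_inclusionE big1 // => b _.
by rewrite (negbTE (neq_lift _ _)) mulr0.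
Qed.

(** A multiple of [d] without component on the saddle [k] is zero, so the plane
    spanned by the other two saddles meets the line of [d] trivially. *)
Lemma fold_in_inj (k : 'I_3) (d : 'cV[C]_3) : d k 0 != 0 ->
  injective (fold_in k d).
Proof.
move=> dk u v /vquot_piP /vlineP[t /colP e].
have t0 : t = 0.
  apply: (mulIf dk); rewrite mul0r.
  by have := e k; rewrite !mxE !saddle_inclusion_omitted subrr.
apply/colP => b; apply/eqP; rewrite -subr_eq0.
by have := e (lift k b); rewrite !mxE !saddle_inclusion_lift t0 mul0r => ->.
Qed.

(** Subtracting a multiple of [d] cancels the component on the saddle [k]. *)
Lemma fold_in_surj (k : 'I_3) (d : 'cV[C]_3) (h : vquot <[d]>%VS) :
  d k 0 != 0 -> exists u, fold_in k d u = h.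
Proof.
move=> dk; set v := vquot_repr h; set t := v k 0 / d k 0.
exists (\col_b (v - t *: d) (lift k b) 0).
rewrite -[RHS]vquot_reprK; apply/vquot_piP/vlineP; exists (- t).
apply/colP => m; rewrite !mxE.
case: (unliftP k m) => [b|] ->; last first.
  by rewrite saddle_inclusion_omitted sub0r mulNr divfK.
by rewrite saddle_inclusion_lift !mxE -/v addrAC subrr sub0r mulNr.
Qed.

Lemma fold_outK (k : 'I_3) (d : 'cV[C]_3) (h : vquot <[d]>%VS) :
  d k 0 != 0 -> fold_in k d (fold_out k h) = h.
Proof.
move=> dk; have [u hu] := fold_in_surj h dk; rewrite /fold_out.
by case: xgetP => [v _ //|/(_ u)] /(_ hu).
Qed.

(** * The monodromy matrix as a change of fold coordinates *)

(** [A] is the passage from the exterior to the interior through [l i] and back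
    to the exterior through [l j]; the second crossing is moved to the left-hand
    side so that no inverse occurs. *)
Definition passage (d : 'cV[C]_3) (i j : 'I_3) (A : 'M[C]_2) : Prop :=
  forall u, fold_in j d (A *m u) = fold_in i d u.

Lemma passage_unit (d : 'cV[C]_3) (i j : 'I_3) (A : 'M[C]_2) :
  d i 0 != 0 -> passage d i j A -> A \in unitmx.
Proof.
move=> di hA; rewrite -unitmx_tr -row_free_unit -kermx_eq0.
apply/rowV0P => v /sub_kermxP vA.
have Av : A *m v^T = 0 by rewrite -[A]trmxK -trmx_mul vA trmx0.
apply: trmx_inj; rewrite trmx0; apply: (fold_in_inj di).
by rewrite -!hA Av mulmx0.
Qed.

Lemma passage_inv (d : 'cV[C]_3) (i j : 'I_3) (A : 'M[C]_2) :
  d i 0 != 0 -> passage d i j A -> passage d j i (invmx A).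
Proof.
by move=> di hA u; rewrite -hA mulKVmx //; exact: passage_unit di hA.
Qed.

(** The two possible values of [boundary_node] inside the caustic near the cusp
    [c k]. *)
Definition cusp_boundary (case_a : bool) (k : 'I_3) : 'cV[C]_3 :=
  \col_i (case_a || (i != k))%:R.

Lemma cusp_boundary_neq0 b (k i : 'I_3) :
  i != k -> cusp_boundary b k i 0 != 0.
Proof. by move=> ik; rewrite mxE ik orbT oner_neq0. Qed.

(** The relation given by [cusp_boundary] eliminates the saddle [j], which
    [E j] omits, in favour of the two saddles that it lists; the columns of the
    matrix are the results. The excluded pair is the one for which
    [cusp_matrix] is itself given as an inverse. *)
Lemma cusp_matrix_passage_direct b (i j k : 'I_3) :
  i != j -> i != k -> j != k -> ~~ ((i == 2 :> nat) && (j == 0 :> nat)) ->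
  passage (cusp_boundary b k) i j (cusp_matrix R b i j).
Proof.
rewrite -!val_eqE => ij ik jk nij u; apply/vquot_piP/vlineP.
(* The multiple of [d] is read off at the saddle [j], which does not occur in
   the image of the fold map of [l j]. *)
exists (- saddle_inclusion i u j 0); apply/colP => m.
rewrite !mxE !saddle_inclusionE !big_ord_recl !big_ord0 !mxE.
rewrite !big_ord_recl !big_ord0 -!val_eqE.
case: i j k ij ik jk nij
  => [[|[|[|//]]] ?] [[|[|[|//]]] ?] [[|[|[|//]]] ?] //= _ _ _ _;
  case: b; case: m => [[|[|[|//]]] ?]; rewrite /= !mxE /=.
all: try ring.
Qed.

Lemma cusp_matrix_passage b (i j k : 'I_3) : i != j -> i != k -> j != k ->
  passage (cusp_boundary b k) i j (cusp_matrix R b i j).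
Proof.
move=> ij ik jk.
have [/andP[i2 j0]|] := boolP ((i == 2 :> nat) && (j == 0 :> nat)); last first.
  exact: cusp_matrix_passage_direct.
have -> : cusp_matrix R b i j = invmx (cusp_matrix R b j i).
  by rewrite /cusp_matrix (eqP i2) (eqP j0).
apply: passage_inv; first exact: cusp_boundary_neq0.
by apply: cusp_matrix_passage_direct; rewrite // 1?eq_sym // (eqP i2) (eqP j0).
Qed.

End FoldMaps.

(** * Flatness of the gluings around a cusp *)

Section Development.
Variables (R : realType) (rev : bool) (ft : 'rV[R]_2 -> R)
  (c : 'I_3 -> 'rV[R]_2) (s : 'I_3 -> 'rV[R]_2 -> 'rV[R]_2)
  (n : 'rV[R]_2 -> 'rV[R]_2) (E : 'I_3 -> set 'rV[R]_2) (k : 'I_3).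

Let d0 : 'cV[R[i]]_3 :=
  cusp_boundary R `[< cusp_case_a rev ft c s n k >] k.

(** The interior carries the condition [d = d0] because its fibre depends on the
    point through the boundary of the node, which has to be constant for the
    developments below to be compatible. *)
Definition local_region (d : 'cV[R[i]]_3) (r : region) : Prop :=
  if r is Some i then i != k else d = d0.

(** On the interior this is the identity when [d = d0]; passing through a
    representative gives it a type for every [d], and so avoids transport along
    an equality of boundary vectors. *)
Definition develop (d : 'cV[R[i]]_3) (r : region) :
    region_fibre d r -> vquot <[d0]>%VS :=
  match r return region_fibre d r -> vquot <[d0]>%VS with
  | Some i => fun u => fold_in i d0 u
  | None => fun h => vquot_pi <[d0]>%VS (vquot_repr h)
  end.

Lemma develop_inj d r : local_region d r -> injective (@develop d r).
Proof.
case: r => [i|] /=.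
  by move=> ik; apply: fold_in_inj; exact: cusp_boundary_neq0.
by move=> -> h h' /=; rewrite !vquot_reprK.
Qed.

(** Each gluing is the comparison of two maps to the common quotient. Across the
    half-line this is what gluing by the inverse of the monodromy achieves: the
    passage from [E i] to [E j] through the interior is undone outside. *)
Lemma develop_region_glue d d' r r' (u : region_fibre d r) :
  local_region d r -> local_region d' r' ->
  develop (region_glue rev ft c s n d' r' u) = develop u.
Proof.
case: r r' u => [j|] [i|] u /=.
- move=> jk ik; case: eqVneq => [-> //|ij].
  (* The cusp common to [l i] and [l j] is [c k]. *)
  have kE : - (i + j) = k.
    apply: val_inj => /=; move: ij jk ik; rewrite -!val_eqE /=.
    by case: (i) (j) (k) => [[|[|[|//]]] ?] [[|[|[|//]]] ?] [[|[|[|//]]] ?].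
  rewrite /cusp_monodromy kE; apply: passage_inv.
    exact: cusp_boundary_neq0.
  exact: cusp_matrix_passage.
- by move=> jk ->; exact: vquot_reprK.
- move=> dd0 ik; move: u; rewrite dd0 => u.
  by rewrite vquot_reprK fold_outK //; exact: cusp_boundary_neq0.
- by move=> dd0 ->; move: u; rewrite dd0 => u; rewrite !vquot_reprK.
Qed.

Lemma develop_glue_along (x y : 'rV[R]_2) (xs : seq 'rV[R]_2)
    (u : fibre rev ft s n E x) :
  (forall z, z \in x :: rcons xs y ->
    local_region (boundary_node rev ft s n z) (region_of E z)) ->
  develop (glue_along c xs y u) = develop u.
Proof.
elim: xs x u => [|z xs IH] x u loc /=.
  by apply: develop_region_glue; apply: loc; rewrite !inE eqxx ?orbT.
have [locx locz] : local_region (boundary_node rev ft s n x) (region_of E x) /\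
    local_region (boundary_node rev ft s n z) (region_of E z).
  by split; apply: loc; rewrite !inE eqxx ?orbT.
rewrite IH; first exact: develop_region_glue.
by move=> w wxs; apply: loc; rewrite inE wxs orbT.
Qed.

Lemma glue_along_closed (x : 'rV[R]_2) (xs : seq 'rV[R]_2)
    (u : fibre rev ft s n E x) :
  (forall z, z \in x :: xs ->
    local_region (boundary_node rev ft s n z) (region_of E z)) ->
  glue_along c xs x u = u.
Proof.
move=> loc; apply: develop_inj; first by apply: loc; rewrite mem_head.
apply: develop_glue_along => z; rewrite inE mem_rcons => /orP[/eqP->|/loc //].
by apply: loc; rewrite mem_head.
Qed.

End Development.

(** * Regions in a neighbourhood of a cusp *)

Section NearCusp.
Variables (R : realType) (rev : bool) (ft : 'rV[R]_2 -> R)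
  (c : 'I_3 -> 'rV[R]_2) (l : 'I_3 -> set 'rV[R]_2)
  (s : 'I_3 -> 'rV[R]_2 -> 'rV[R]_2) (n : 'rV[R]_2 -> 'rV[R]_2)
  (a E : 'I_3 -> set 'rV[R]_2) (e : 'I_3 -> 'I_3 -> 'rV[R]_2 -> 'rV[R]_2).

Lemma tricuspoid_cusp (K : set 'rV[R]_2) (k : 'I_3) :
  tricuspoid K c l -> K (c k).
Proof. by move=> [g [_ [_ ->] _ _ /(_ k)[-> _]]]; exists (k%:R / 3). Qed.

Lemma tricuspoid_cusp_notin_side (K : set 'rV[R]_2) (k : 'I_3) :
  tricuspoid K c l -> ~ l k (c k).
Proof.
move=> [g [[_ per] [inj _] _ _ /(_ k)[-> ->]]] [t /=].
rewrite in_itv /= => /andP[t1 t2].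
(* For the last side the parameters lie between 1 and 4/3 and are shifted by
   the period to return to the domain of injectivity. *)
have [k2|] := eqVneq (k : nat) 2.
  move: t1 t2; rewrite k2 => t1 t2.
  rewrite -[t](subrK 1) per => /inj; rewrite !in_itv /=; lra.
case: k t1 t2 => [[|[|[|//]]] ?] //= t1 t2 _ /inj; rewrite !in_itv /=; lra.
Qed.

Hypotheses (Hft : generic_perturbation rev ft c l s n)
  (HA : exterior_cut rev ft c l s a E e).

Lemma part_off_walls (k : 'I_3) x : E k x ->
  outside (caustic ft) x /\ ~ (\bigcup_i a i) x.
Proof.
move=> Ex; suff : (\bigcup_i E i) x by rewrite (ec_part_cover HA).
by exists k.
Qed.

(** The vertex of a half-line belongs to it, so disjointness of the half-lines
    separates [c k] from the two that bound [E k]. *)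
Lemma cusp_not_closure_part (k : 'I_3) : ~ closure (E k) (c k).
Proof.
rewrite (ec_part_closure HA) => -[[|]|[i /= ik aic]].
- move=> /part_off_walls[[+ _] _]; apply.
  exact: tricuspoid_cusp (gp_tricuspoid Hft).
- exact: tricuspoid_cusp_notin_side (gp_tricuspoid Hft).
- have : (a i `&` a k) (c k).
    by split=> //; have [g [[_ <-] _ _ _ ->]] := ec_half_line HA k;
      exists 0 => //=; rewrite in_itv /= lexx.
  by rewrite (ec_disjoint HA ik).
Qed.

Lemma near_cusp_not_part (k : 'I_3) : \forall x \near c k, ~ E k x.
Proof.
have oC : open (~` closure (E k)) by apply: closed_openC; exact: closed_closure.
have := open_nbhs_nbhs (conj oC (@cusp_not_closure_part k)).
by apply: filterS => x nEx Ex; apply: nEx; exact: subset_closure.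
Qed.

Lemma near_cusp_boundary (k : 'I_3) :
  cusp_case_a rev ft c s n k \/ cusp_case_b rev ft c s n k ->
  \forall x \near c k, inside (caustic ft) x ->
    boundary_node rev ft s n x =
    cusp_boundary R `[< cusp_case_a rev ft c s n k >] k.
Proof.
move=> Hcase; case: asboolP => [|na].
  apply: filterS => x hx /hx h; apply/colP => i.
  by rewrite !mxE h.
case: Hcase => // ; apply: filterS => x hx /hx h; apply/colP => i.
by rewrite !mxE h.
Qed.

(** A point off the walls and in no exterior part is inside the caustic, since
    the parts cover the exterior up to the half-lines. *)
Lemma near_cusp_local_region (k : 'I_3) :
  cusp_case_a rev ft c s n k \/ cusp_case_b rev ft c s n k ->
  \forall x \near c k, ~ (caustic ft `|` \bigcup_i a i) x ->
    local_region rev ft c s n k (boundary_node rev ft s n x) (region_of E x).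
Proof.
move=> Hcase; near=> x => nwx.
rewrite /region_of; case: pickP => [i /asboolP Eix | noE] /=.
  by apply/eqP => ik; move: Eix; rewrite ik; near: x; exact: near_cusp_not_part.
have ins : inside (caustic ft) x; last first.
  by move: ins; near: x; exact: near_cusp_boundary.
have nKx : ~ caustic ft x by move=> Kx; apply: nwx; left.
split=> //; apply: contrapT => unb.
have : (\bigcup_i E i) x.
  by rewrite (ec_part_cover HA); split=> // ax; apply: nwx; right.
by move=> [i _ Eix]; have /asboolP := noE i.
Unshelve. all: by end_near. Qed.

End NearCusp.

Theorem proposition5p19 (R : realType) (rev : bool) (ft : 'rV[R]_2 -> R)
  (c : 'I_3 -> 'rV[R]_2) (l : 'I_3 -> set 'rV[R]_2)
  (s : 'I_3 -> 'rV[R]_2 -> 'rV[R]_2) (n : 'rV[R]_2 -> 'rV[R]_2)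
  (a E : 'I_3 -> set 'rV[R]_2) (e : 'I_3 -> 'I_3 -> 'rV[R]_2 -> 'rV[R]_2)
  (Hft : generic_perturbation rev ft c l s n)
  (Hcase : forall k, cusp_case_a rev ft c s n k \/ cusp_case_b rev ft c s n k)
  (HA : exterior_cut rev ft c l s a E e) :
  forall k : 'I_3, extends_across rev ft c s n a E (c k).
Proof.
move=> k; pose walls := caustic ft `|` \bigcup_i a i.
pose U := [set x | ~ bifurcation rev ft x /\ (~ walls x ->
  local_region rev ft c s n k (boundary_node rev ft s n x) (region_of E x))].
exists U; split.
- apply: filterI; first exact: (gp_cusp_bifurcation Hft k).
  exact: (near_cusp_local_region Hft HA (Hcase k)).
- by rewrite -subset0 => x [[]].
- move=> g ts _ gU _ [lt_ts off _] u; apply: glue_along_closed => z zs.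
  have [t trs ->] : exists2 t, t \in 0 :: ts & z = g t.
    by apply/mapP.
  have t_rs : t \in 0 :: rcons ts 1.
    by move: trs; rewrite !inE mem_rcons inE => /orP[->|->]; rewrite ?orbT.
  apply: (gU (g t) _).2; last exact: off.
  exists t => //=; rewrite in_itv /=.
  move: lt_ts; rewrite (sorted_pairwise lt_trans) -rcons_cons pairwise_rcons.
  rewrite pairwise_cons => /and3P[/allP lt1 /allP gt0 _].
  rewrite (ltW (lt1 t trs)) andbT.
  by move: trs; rewrite inE => /predU1P[-> //|/gt0/ltW].
Qed.
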